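(* Let $d$ be a positive integer and let $\{\mathbb{P}_n\}_{n\ge 0}$ be a monic orthogonal polynomial system in $d$ variables satisfying the three term relation $$x_i\,\mathbb{P}_n=A_{n,i}\,\mathbb{P}_{n+1}+B_{n,i}\,\mathbb{P}_n+C_{n,i}\,\mathbb{P}_{n-1},\qquad n\ge0,\ 1\le i\le d,\qquad \mathbb{P}_{-1}=0.$$ Let $M_n$, $n\ge 1$, be constant real matrices of size $r_n^d\times r_{n-1}^d$ with $\operatorname{rank}M_1=1$, and define the polynomial system $\{\mathbb{Q}_n\}_{n\ge0}$ by $$\mathbb{Q}_0=\mathbb{P}_0,\qquad \mathbb{Q}_n=\mathbb{P}_n+M_n\,\mathbb{P}_{n-1},\quad n\ge 1 .$$ For $1\le i\le d$ put $$\tilde A_{n,i}=A_{n,i}=L_{n,i},\qquad n\ge 0,$$ $$\tilde B_{n,i}=B_{n,i}+M_nA_{n-1,i}-\tilde A_{n,i}M_{n+1},\qquad n\ge 0,$$ $$\tilde C_{n,i}=C_{n,i}+M_nB_{n-1,i}-\tilde B_{n,i}M_n,\qquad n\ge 1,$$ where, by convention $M_0=0$, the term $M_nA_{n-1,i}$ is $0$ for $n=0$. Then $\{\mathbb{Q}_n\}_{n\ge0}$ is a monic orthogonal polynomial system satisfying the three term relation $$x_i\,\mathbb{Q}_n=\tilde A_{n,i}\,\mathbb{Q}_{n+1}+\tilde B_{n,i}\,\mathbb{Q}_n+\tilde C_{n,i}\,\mathbb{Q}_{n-1},\qquad n\ge0,\ 1\le i\le d,\qquad \mathbb{Q}_{-1}=0,$$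 if and only if $$M_n\,C_{n-1,i}=\tilde C_{n,i}\,M_{n-1},\qquad n\ge 2,\ 1\le i\le d,$$ and, for all $n\ge 0$, $$\operatorname{rank}\tilde C_{n+1,i}=r_n^d,\quad 1\le i\le d,\qquad\text{and}\qquad \operatorname{rank}\tilde C_{n+1}^t=r_{n+1}^d,$$ where $\tilde C_{n+1}^t$ denotes the joint matrix of $\tilde C_{n+1,1}^t,\dots,\tilde C_{n+1,d}^t$.
   Context: $\Pi^d$ is the space of real polynomials in $d$ variables $\mathtt{x}=(x_1,\dots,x_d)$, and $\Pi^d_n$ its subspace of polynomials of total degree at most $n$ (with $\Pi^d_{-1}=\{0\}$). $r_n^d=\binom{n+d-1}{d-1}$ is the number of monomials of total degree $n$. $\mathbb{X}_n$ is the column vector of all monomials $\mathtt{x}^\alpha$, $|\alpha|=n$, arranged in reverse lexicographical order (for $d=2$: $x_1^n,x_1^{n-1}x_2,\dots,x_2^n$). $L_{n,i}$ is the $r_n^d\times r_{n+1}^d$ matrix defined by $L_{n,i}\,\mathbb{X}_{n+1}=x_i\,\mathbb{X}_n$, $1\le i\le d$. The joint matrix of matrices $N_1,\dots,N_d$ of the same size $h\times k$ is the $dh\times k$ matrix obtained by stacking them vertically, $(N_1^t,\dots,N_d^t)^t$; thus $\tilde C_{n+1}^t$ is the $d\,r_n^d\times r_{n+1}^d$ matrix with blocks $\tilde C_{n+1,1}^t,\dots,\tilde C_{n+1,d}^t$ stacked vertically. A polynomial system (PS) is a sequence $\{\mathbb{P}_n\}_{n\ge0}$ where $\mathbb{P}_n$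 is a column vector of $r_n^d$ polynomials of total degree $n$ that are linearly independent modulo $\Pi^d_{n-1}$. It is monic if, for every $n\ge 0$, all entries of $\mathbb{P}_n-\mathbb{X}_n$ lie in $\Pi^d_{n-1}$ (in particular $\mathbb{P}_0=1$). A moment functional is a linear functional $u:\Pi^d\to\mathbb{R}$; it acts entrywise on matrices of polynomials. A PS $\{\mathbb{P}_n\}_{n\ge 0}$ is an orthogonal polynomial system (OPS) with respect to $u$ if $\langle u,\mathbb{P}_n\mathbb{P}_m^t\rangle=0$ for $n\ne m$ and $\langle u,\mathbb{P}_n\mathbb{P}_n^t\rangle=H_n$ is a (symmetric) non-singular matrix for all $n\ge 0$. A monic orthogonal polynomial system is a monic PS that is an OPS with respect to some moment functional. For a monic orthogonal polynomial system $\{\mathbb{P}_n\}_{n\ge0}$, the coefficients in its three term relation are real matrices $A_{n,i},B_{n,i},C_{n,i}$ of sizes $r_n^d\times r_{n+1}^d$, $r_n^d\times r_n^d$, $r_n^d\times r_{n-1}^d$; comparing leading coefficients gives $A_{n,i}=L_{n,i}$, and the rank conditions $\operatorname{rank}A_{n,i}=\operatorname{rank}C_{n+1,i}=r_n^d$ ($1\le i\le d$) and $\operatorname{rank}(A_{n,1}^t,\dots,A_{n,d}^t)^t=\operatorname{rank}(C_{n+1,1},\dots,C_{n+1,d})^t=r_{n+1}^d$ hold for all $n\ge0$. *)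

(* Defs.v *)
From mathcomp Require Import all_boot all_order all_algebra.
From mathcomp Require Import reals.
From mathcomp Require Import mpoly.

Set Implicit Arguments.
Unset Strict Implicit.
Unset Printing Implicit Defensive.

Import Order.TTheory GRing.Theory Num.Theory.
Local Open Scope ring_scope.

Definition r (d n : nat) : nat := 'C(n + d - 1, d - 1).

(* The order [<=%O] on 'X_{1..d} compares total degrees, then the exponent
   sequences lexicographically; among monomials of degree n the decreasing
   enumeration is thus x_1^n, x_1^(n-1) x_2, ..., x_d^n. *)
Definition monomials (d n : nat) : seq 'X_{1..d} :=
  sort >=%O [seq bmnm m | m : 'X_{1..d < n.+1} in [pred m | mdeg (bmnm m) == n]].

(* The default value is never used when 0 < d (see size_monomials). *)
Definition monomial (d n : nat) (k : 'I_(r d n)) : 'X_{1..d} :=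
  nth 0%MM (monomials d n) k.

Lemma mem_monomials d n m : (m \in monomials d n) = (mdeg m == n).
Proof.
rewrite /monomials mem_sort; apply/imageP/idP => [[b hb ->] | /eqP hm].
  by move: hb; rewrite inE.
have lt : (mdeg m < n.+1)%N by rewrite hm.
by exists (BMultinom lt); rewrite // inE /= hm.
Qed.

Lemma uniq_monomials d n : uniq (monomials d n).
Proof.
by rewrite /monomials sort_uniq map_inj_uniq ?enum_uniq //; apply: val_inj.
Qed.

Lemma size_monomials d n : (0 < d)%N -> size (monomials d n) = r d n.
Proof.
case: d => // d _; rewrite /r addnS !subSS !subn0.
rewrite -(bin_sub (leq_addl n d)) addnK -size_basis.
apply/perm_size/uniq_perm; rewrite ?uniq_monomials ?uniq_basis // => m.
by rewrite mem_monomials basis_cover.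
Qed.

Section Systems.

Variables (R : realType) (d : nat).

(* A sequence of column vectors, the n-th one with r d n polynomial entries. *)
Definition vecseq := forall n, 'cV[{mpoly R[d]}]_(r d n).

Definition monvec : vecseq := fun n => \col_k 'X_[monomial k].

Definition cmx m n (A : 'M[R]_(m, n)) : 'M[{mpoly R[d]}]_(m, n) :=
  map_mx (@mpolyC d R) A.

(* Row a lists the coefficients of x_i x^a on the monomials of degree n + 1;
   lead_mxP is the defining identity. *)
Definition lead_mx (n : nat) (i : 'I_d) : 'M[R]_(r d n, r d n.+1) :=
  \matrix_(a, b) ('X_i * monvec n a 0)@_(monomial b).

Lemma lead_mxP n i : (0 < d)%N ->
  cmx (lead_mx n i) *m monvec n.+1 = 'X_i *: monvec n.
Proof.
move=> d0; apply/colP => a; rewrite !mxE.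
pose m := (U_(i) + monomial a)%MM.
have hm : m \in monomials d n.+1.
  rewrite mem_monomials mdegD mdeg1 add1n eqSS -mem_monomials.
  by rewrite mem_nth // size_monomials.
have lt : (index m (monomials d n.+1) < r d n.+1)%N.
  by rewrite -size_monomials // index_mem.
have em : monomial (Ordinal lt) = m by rewrite /monomial nth_index.
rewrite -mpolyXD -/m (bigD1 (Ordinal lt)) //= big1 ?addr0 => [|b neq].
  by rewrite !mxE -mpolyXD -/m em mcoeffX eqxx mpolyC1 mul1r.
rewrite !mxE -mpolyXD -/m mcoeffX -em nth_uniq ?uniq_monomials //;
  rewrite ?size_monomials //.
case: eqP => [/val_inj e|_]; last by rewrite mpolyC0 mul0r.
by rewrite e eqxx in neq.
Qed.

(* [msize] is the total degree plus one, and 0 for the zero polynomial, so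
   that [msize p <= n] says that p has degree at most n - 1, with p = 0 when
   n = 0. *)
Definition poly_system (P : vecseq) : Prop :=
  forall n, (forall k, msize (P n k 0) = n.+1) /\
    (forall c : 'I_(r d n) -> R,
       (msize (\sum_k c k *: P n k 0)%R <= n)%N -> forall k, c k = 0).

Definition monic_system (P : vecseq) : Prop :=
  poly_system P /\
  forall n k, (msize ((P n - monvec n) k 0)%R <= n)%N.

Definition orthogonal_for (u : {scalar {mpoly R[d]}}) (P : vecseq) : Prop :=
  [/\ poly_system P,
      (forall n m, n <> m -> map_mx u (P n *m (P m)^T) = 0) &
      (forall n, (map_mx u (P n *m (P n)^T) : 'M[R]_(r d n)) \in unitmx)].

Definition monic_orthogonal (P : vecseq) : Prop :=
  monic_system P /\ exists u : {scalar {mpoly R[d]}}, orthogonal_for u P.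

(* P_(n-1), with P_(-1) = 0.  At n = 0 the index n.-1 is 0, so P_(-1) is
   represented by the zero vector of size r d 0. *)
Definition prevvec (P : vecseq) (n : nat) : 'cV[{mpoly R[d]}]_(r d n.-1) :=
  match n return 'cV_(r d n.-1) with
  | 0%N => 0
  | m.+1 => P m
  end.

(* Since C 0 i is multiplied by P_(-1) = 0, its value is irrelevant. *)
Definition three_term
    (A : forall n, 'I_d -> 'M[R]_(r d n, r d n.+1))
    (B : forall n, 'I_d -> 'M[R]_(r d n, r d n))
    (C : forall n, 'I_d -> 'M[R]_(r d n, r d n.-1)) (P : vecseq) : Prop :=
  forall n i, 'X_i *: P n =
    cmx (A n i) *m P n.+1 + cmx (B n i) *m P n + cmx (C n i) *m prevvec P n.

(* Q_0 = P_0 and Q_n = P_n + M_n P_(n-1).  The matrix M 0, which has no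
   counterpart, is used nowhere. *)
Definition linrel (M : forall n, 'M[R]_(r d n, r d n.-1)) (P : vecseq) :
    vecseq := fun n =>
  match n return 'cV_(r d n) with
  | 0%N => P 0%N
  | m.+1 => P m.+1 + cmx (M m.+1) *m P m
  end.

Section Coefficients.

Variables (A : forall n, 'I_d -> 'M[R]_(r d n, r d n.+1))
  (B : forall n, 'I_d -> 'M[R]_(r d n, r d n))
  (C : forall n, 'I_d -> 'M[R]_(r d n, r d n.-1))
  (M : forall n, 'M[R]_(r d n, r d n.-1)).

Definition MA (n : nat) (i : 'I_d) : 'M[R]_(r d n) :=
  match n return 'M_(r d n) with
  | 0%N => 0
  | m.+1 => M m.+1 *m A m i
  end.

Definition Btilde (n : nat) (i : 'I_d) : 'M[R]_(r d n) :=
  B n i + MA n i - lead_mx n i *m M n.+1.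

(* Meaningful for n >= 1 only. *)
Definition Ctilde (n : nat) (i : 'I_d) : 'M[R]_(r d n, r d n.-1) :=
  C n i + M n *m B n.-1 i - Btilde n i *m M n.

End Coefficients.

End Systems.

(* Main.v *)
Require Import Defs.
From HB Require Import structures.
From mathcomp Require Import all_boot all_order all_algebra.
From mathcomp Require Import reals.
From mathcomp Require Import mpoly.
From mathcomp Require Import ring.

(** Expanding [x_i Q_n] with [Q_n = P_n + M_n P_(n-1)] and the recurrence of
    [P], then regrouping in terms of the [Q_k], gives the
    coefficients [L_(n,i)], [Btilde], [Ctilde] and exactly one further term,
    [(M_n C_(n-1,i) - Ctilde_(n,i) M_(n-1)) P_(n-2)] ([linrel_expansion]).  The
    entries of [P_(n-2)] being linearly independent, the recurrence for [Q] is
    equivalent to the commutation relations.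

    It remains to see that, for a monic system [Q] with a three term relation,
    being orthogonal amounts to the rank conditions.  The link is
    [C_(n+1,i) H_n = H_(n+1) L_(n,i)^T], obtained by computing
    [u (x_i Q_(n+1) Q_n^T)] in two ways ([gram_recurrence]), where
    [H_n = u (Q_n Q_n^T)].  The matrices [L_(n,i)] have independent rows, and no
    nonzero vector is killed by all of them at once, because every monomial of
    degree [n+1] is some [x_i] times a monomial of degree [n].  Hence, once
    [H_n] is invertible, [H_(n+1)] is invertible if and only if the joint matrix
    of the [C_(n+1,i)^T] has full column rank ([unitmx_joint_rank]), and then
    each [C_(n+1,i)] has the rank of [L_(n,i)].

    For an orthogonal [Q] this gives the rank conditions.  Conversely, the
    functional is not that of [P]: it has to kill every [Q_n] with [n > 0], so
    it is the coordinate along [Q_0 = 1] in the basis formed by the entries of all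
    the [Q_n] ([exists_dual]).  The three term relation then propagates
    [u (Q_n) = 0] to [u (x^m Q_n) = 0] for [|m| < n] by moving the variables of
    [x^m] onto [Q_n] one at a time ([orth_low_monomials]), and the [H_n] are
    invertible by induction on [n] ([favard]). *)

Set Implicit Arguments.
Unset Strict Implicit.
Unset Printing Implicit Defensive.

Import GRing.Theory.
Local Open Scope ring_scope.

(** * Ranks across a recurrence between square matrices *)

Section LinearAlgebra.

Variable F : fieldType.

(** Full column rank of a joint matrix means that the matrices stacked in it
    have no common nonzero kernel vector, a form that does not mention the
    stacking. *)
Lemma rank_mxcol_trP (I m n : nat) (C : 'I_I -> 'M[F]_(m, n)) :
  \rank (\mxcol_(i < I) (C i)^T) = m <->
  (forall w : 'rV_m, (forall i, w *m C i = 0) -> w = 0).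
Proof.
set J := \mxcol_(i < I) _.
have kerJ (w : 'rV_m) : w *m J^T = 0 <-> forall i, w *m C i = 0.
  rewrite tr_mxcol mul_mxrow -(mxrow0 (q_ := fun=> n)).
  rewrite -(eq_mxrowP (fun i => w *m ((C i)^T)^T) (fun=> 0)).
  by split=> wC i; move: (wC i); rewrite trmxK.
rewrite -mxrank_tr; split=> [rJ w /kerJ wJ|inj].
  by apply/eqP; rewrite -(@mulmx_free_eq0 _ _ _ _ _ J^T) ?wJ // /row_free rJ.
by apply/eqP/inj_row_free => w /kerJ; apply: inj.
Qed.

Lemma unitmxP_row n (H : 'M[F]_n) :
  H \in unitmx <-> (forall w : 'rV_n, w *m H = 0 -> w = 0).
Proof.
rewrite -row_free_unit; split=> [fH w wH|]; last exact: inj_row_free.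
by apply/eqP; rewrite -(mulmx_free_eq0 w fH) wH.
Qed.

(** [H] and [H'] stand for consecutive Gram matrices, [L] and [C] for the
    leading and the trailing coefficients of a three term relation. *)
Section Step.

Variables (I m n : nat) (H : 'M[F]_m) (H' : 'M[F]_n).
Variables (L : 'I_I -> 'M[F]_(m, n)) (C : 'I_I -> 'M[F]_(n, m)).
Hypothesis unitH : H \in unitmx.
Hypothesis CH : forall i, C i *m H = H' *m (L i)^T.

(** A row vector is killed by [H'] exactly when it is killed by all the [C i]:
    multiply by [H] in one direction, use the injectivity of the [L i] in the
    other. *)
Lemma unitmx_joint_rank :
    (forall w : 'rV_n, (forall i, w *m (L i)^T = 0) -> w = 0) ->
  H' \in unitmx <-> \rank (\mxcol_(i < I) (C i)^T) = n.
Proof.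
move=> injL; rewrite unitmxP_row rank_mxcol_trP.
have ker (w : 'rV_n) : w *m H' = 0 <-> forall i, w *m C i = 0.
  split=> [wH' i|wC].
    apply/eqP; rewrite -(mulmx_free_eq0 _ (B := H)) ?row_free_unit //.
    by rewrite -mulmxA CH mulmxA wH' mul0mx.
  by apply: injL => i; rewrite -mulmxA -CH mulmxA wC mul0mx.
by split=> inj w /ker; apply: inj.
Qed.

Lemma rank_of_gram i : H' \in unitmx -> row_free (L i) -> \rank (C i) = m.
Proof.
move=> unitH' /eqP rL; have fH : row_free H by rewrite row_free_unit.
rewrite -(mxrankMfree _ fH) //.
by rewrite CH (eqmxMfull (A := H')) ?row_full_unit // mxrank_tr.
Qed.

End Step.
End LinearAlgebra.

(** The cancellations behind the definitions of the perturbed coefficients: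
    [lm], [bm] and [cm] are the terms that the perturbation of the new vectors
    adds, and that the new coefficients subtract. *)
Lemma regroup (V : zmodType) (lp bp cp ml mb mc lm bm cm : V) :
  lp + bp + cp + (ml + mb + mc) =
  lp + lm + (bp + ml - lm + bm) + (cp + mb - bm + cm) + (mc - cm).
Proof.
rewrite (addrA (lp + lm)) (addrACA lp) subrr addr0.
rewrite (addrA (_ + bm)) (addrACA _ bm) subrr addr0.
rewrite (addrACA _ cm) subrr addr0 (addrA _ _ mc); congr (_ + mc).
by rewrite (addrACA _ cp) (addrA lp).
Qed.

(** * Monomials and monic systems *)

(** Degree bounds become vanishing conditions on coefficients, which are
    linear. *)
Lemma msize_leP (S : nzRingType) (d : nat) (p : {mpoly S[d]}) n :
  (msize p <= n)%N <-> (forall m, (n <= mdeg m)%N -> p@_m = 0).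
Proof.
split=> [sp m nm|p0].
  by apply/eqP; rewrite mcoeff_eq0 msize_mdeg_ge // (leq_trans sp).
rewrite msizeE; apply/bigmax_leqP_seq => m + _.
by rewrite mcoeff_msupp ltnNge; apply: contraNN => /p0 ->.
Qed.

Lemma mdegS_split d n (m : 'X_{1..d}) : mdeg m = n.+1 ->
  exists i m', [/\ m = (U_(i) + m')%MM & mdeg m' = n].
Proof.
move=> deg; have [i hi] : exists i, (0 < m i)%N.
  apply/existsP; apply: contraT => /existsPn m0.
  move: deg; rewrite mdegE big1 // => i _.
  by apply/eqP; move: (m0 i); rewrite lt0n negbK.
have le : (U_(i) <= m)%MM by rewrite lep1mP -lt0n.
exists i, (m - U_(i))%MM; split; first by rewrite addmC submK.
apply/eqP; rewrite -(eqn_add2r (mdeg U_(i))) -mdegD submK //.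
by rewrite deg mdeg1 addn1.
Qed.

Section Systems.

Variables (R : realType) (d : nat).
Hypothesis d_gt0 : (0 < d)%N.

Implicit Types (p q : {mpoly R[d]}) (P Q : vecseq R d).

Lemma mdeg_monomial n (k : 'I_(r d n)) : mdeg (monomial k) = n.
Proof. by apply/eqP; rewrite -mem_monomials mem_nth ?size_monomials. Qed.

Lemma monomial_inj n : injective (@monomial d n).
Proof.
move=> j k /eqP.
by rewrite nth_uniq ?uniq_monomials ?size_monomials // => /eqP/val_inj.
Qed.

Lemma monomial_surj n (m : 'X_{1..d}) : mdeg m = n ->
  exists k : 'I_(r d n), monomial k = m.
Proof.
move=> deg; have hm : m \in monomials d n by rewrite mem_monomials deg.
have lt : (index m (monomials d n) < r d n)%N.
  by rewrite -size_monomials // index_mem.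
by exists (Ordinal lt); rewrite /monomial nth_index.
Qed.

(** Being monic already implies being a polynomial system, since the leading
    parts are the distinct monomials (see [monic_systemP]). *)
Definition monic_leading Q :=
  forall n k, (msize ((Q n - monvec R d n) k 0)%R <= n)%N.

(** The part of degree at least [n] of the [k]-th entry is one monomial; all
    the independence statements are read off from it. *)
Lemma monic_coeff Q n k m : monic_leading Q -> (n <= mdeg m)%N ->
  (Q n k 0)@_m = (monomial k == m)%:R.
Proof.
move=> /(_ n k)/msize_leP/(_ m) monQ /monQ.
by rewrite !mxE mcoeffB mcoeffX => /eqP; rewrite subr_eq0 => /eqP.
Qed.

Lemma monic_coeff_high Q n k m : monic_leading Q -> (n < mdeg m)%N ->
  (Q n k 0)@_m = 0.
Proof.
move=> monQ nm; rewrite (monic_coeff _ monQ) ?(ltnW nm) //.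
by case: eqP nm => // <-; rewrite mdeg_monomial ltnn.
Qed.

Lemma monic_msize Q n k : monic_leading Q -> msize (Q n k 0) = n.+1.
Proof.
move=> monQ; apply/eqP; rewrite eqn_leq; apply/andP; split.
  by apply/msize_leP => m; apply: monic_coeff_high.
rewrite -{1}(mdeg_monomial k); apply: msize_mdeg_lt.
by rewrite mcoeff_msupp (monic_coeff _ monQ) ?mdeg_monomial // eqxx oner_neq0.
Qed.

Lemma monic_comb_coeff Q n (c : 'I_(r d n) -> R) k : monic_leading Q ->
  (\sum_j c j *: Q n j 0)@_(monomial k) = c k.
Proof.
move=> monQ; rewrite raddf_sum /= (bigD1 k) //= big1 => [|j jk].
  by rewrite addr0 mcoeffZ (monic_coeff _ monQ) ?mdeg_monomial // eqxx mulr1.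
rewrite mcoeffZ (monic_coeff _ monQ) ?mdeg_monomial //.
by rewrite (inj_eq (@monomial_inj _)) (negbTE jk) mulr0.
Qed.

Lemma cmx_mulE Q m n (N : 'M[R]_(m, r d n)) a :
  (cmx d N *m Q n) a 0 = \sum_k N a k *: Q n k 0.
Proof. by rewrite mxE; apply: eq_bigr => k _; rewrite mxE mul_mpolyC. Qed.

Lemma cmx_mul_coeff_high Q l n (N : 'M[R]_(l, r d n)) a m :
  monic_leading Q -> (n < mdeg m)%N -> ((cmx d N *m Q n) a 0)@_m = 0.
Proof.
move=> monQ nm; rewrite cmx_mulE raddf_sum big1 //= => k _.
by rewrite mcoeffZ (monic_coeff_high _ monQ) ?mulr0.
Qed.

Lemma cmx_mul_eq0 Q m n (N : 'M[R]_(m, r d n)) : monic_leading Q ->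
  cmx d N *m Q n = 0 -> N = 0.
Proof.
move=> monQ NQ; apply/matrixP => a k.
by rewrite -(monic_comb_coeff (N a) k monQ) -cmx_mulE NQ !mxE mcoeff0.
Qed.

Lemma monic_systemP Q : monic_leading Q -> monic_system Q.
Proof.
move=> monQ; split=> // n; split=> [k|c]; first exact: monic_msize.
move=> /msize_leP sc k.
by rewrite -(monic_comb_coeff c k monQ) sc ?mdeg_monomial.
Qed.

Lemma monic0 Q k : monic_leading Q -> Q 0%N k 0 = 1.
Proof.
move=> monQ; apply/mpolyP => m; rewrite (monic_coeff _ monQ) // mcoeff1 eq_sym.
by congr (_ == _)%:R; apply/eqP; rewrite -mdeg_eq0 mdeg_monomial.
Qed.

Lemma lead_mxE n (i : 'I_d) (a : 'I_(r d n)) (b : 'I_(r d n.+1)) :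
  lead_mx R n i a b = ((U_(i) + monomial a)%MM == monomial b)%:R.
Proof. by rewrite !mxE -mpolyXD mcoeffX. Qed.

(** Each row holds a single one, in a column that determines the row, because
    multiplication of monomials by [x_i] is injective. *)
Lemma row_free_lead n (i : 'I_d) : row_free (lead_mx R n i).
Proof.
apply: inj_row_free => w wL; apply/rowP => a; rewrite mxE.
have deg : mdeg (U_(i) + monomial a)%MM = n.+1.
  by rewrite mdegD mdeg1 mdeg_monomial.
have [b hb] := monomial_surj deg.
move: wL => /rowP/(_ b); rewrite !mxE (bigD1 a) //= big1 => [|a' aa'].
  by rewrite addr0 lead_mxE hb eqxx mulr1.
rewrite lead_mxE hb eqm_add2l (inj_eq (@monomial_inj _)) (negbTE aa').
by rewrite mulr0.
Qed.

(** The coordinate of [w] at a monomial [x_i x^m] is an entry of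
    [w *m (lead_mx R n i)^T], and every monomial of positive degree has this
    form. *)
Lemma lead_mx_joint_inj n (w : 'rV[R]_(r d n.+1)) :
  (forall i : 'I_d, w *m (lead_mx R n i)^T = 0) -> w = 0.
Proof.
move=> wL; apply/rowP => b; rewrite mxE.
have [i [m [bE /monomial_surj[a ha]]]] := mdegS_split (mdeg_monomial b).
move: (wL i) => /rowP/(_ a); rewrite !mxE (bigD1 b) //= big1 => [|b' bb'].
  by rewrite addr0 mxE lead_mxE ha -bE eqxx mulr1.
rewrite mxE lead_mxE ha -bE (inj_eq (@monomial_inj _)).
by rewrite eq_sym (negbTE bb') mulr0.
Qed.

(** * The functional that kills all members of positive degree *)

Section Dual.

Variable Q : vecseq R d.
Hypothesis monQ : monic_leading Q.

(** Subtracting the component along the [n]-th vector lowers the degree of a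
    polynomial of degree [n]. *)
Definition strip n p := p - \sum_k p@_(monomial k) *: Q n k 0.

(** After removing the components of degrees [N], ..., 1, what remains of a
    polynomial of degree at most [N] is its coordinate along [Q 0 = 1].  The
    recursion is on [N] rather than on the polynomial, so that linearity is
    immediate; [dualE] shows that [N] does not matter once it is large. *)
Fixpoint dual_upto N p : R :=
  if N is N'.+1 then dual_upto N' (strip N p) else p@_0.

Definition dual p : R := dual_upto (msize p).-1 p.

Lemma strip_low n p : (msize p <= n)%N -> strip n p = p.
Proof.
move=> /msize_leP sp; rewrite /strip big1 ?subr0 // => k _.
by rewrite sp ?scale0r ?mdeg_monomial.
Qed.

Lemma strip_monic n k : strip n (Q n k 0) = 0.
Proof.
rewrite /strip (bigD1 k) //= big1 => [|j jk].
  by rewrite (monic_coeff _ monQ) ?mdeg_monomial // eqxx scale1r addr0 subrr.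
rewrite (monic_coeff _ monQ) ?mdeg_monomial //.
by rewrite (inj_eq (@monomial_inj _)) eq_sym (negbTE jk) scale0r.
Qed.

Lemma strip_linear n : linear (strip n).
Proof.
move=> c p q; rewrite /strip scalerBr addrACA -opprD scaler_sumr -big_split.
congr (_ - _); apply: eq_bigr => k _.
by rewrite mcoeffD mcoeffZ scalerDl scalerA.
Qed.

Lemma dual_upto_linear N c p q :
  dual_upto N (c *: p + q) = c * dual_upto N p + dual_upto N q.
Proof.
elim: N p q => [|N IH] p q /=; first by rewrite mcoeffD mcoeffZ.
by rewrite strip_linear IH.
Qed.

Lemma dualE N p : (msize p <= N.+1)%N -> dual p = dual_upto N p.
Proof.
move=> sp; have le : ((msize p).-1 <= N)%N by case: (msize p) sp.
rewrite /dual -(subnK le); elim: (N - _)%N => //= j ->.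
by rewrite strip_low //; case: (msize p) => // s; rewrite ltnS leq_addl.
Qed.

Lemma dual_is_linear : scalar dual.
Proof.
move=> c p q; pose N := maxn (msize p) (msize q).
have [sp sq] : (msize p <= N.+1)%N /\ (msize q <= N.+1)%N.
  by split; apply/leqW; rewrite /N ?leq_maxl ?leq_maxr.
rewrite (dualE sp) (dualE sq) -dual_upto_linear; apply: dualE.
apply/msize_leP => m Nm; rewrite mcoeffD mcoeffZ.
by move/msize_leP: sp => ->//; move/msize_leP: sq => ->//; rewrite mulr0 addr0.
Qed.

Lemma exists_dual : exists u : {scalar {mpoly R[d]}},
  u 1 = 1 /\ forall n, map_mx u (Q n.+1) = 0.
Proof.
pose um := GRing.isLinear.Build R {mpoly R[d]} R^o *%R dual dual_is_linear.
pose u : {scalar {mpoly R[d]}} := HB.pack dual um.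
exists u; split=> [|n]; first by rewrite /= (@dualE 0) ?msize1 //= mcoeff1 eqxx.
apply/colP => k; rewrite !mxE /= (@dualE n.+1) ?monic_msize //= strip_monic.
by have := dual_upto_linear n (-1) 0 0; rewrite scaler0 addr0 mulN1r addNr.
Qed.

End Dual.

(** * Orthogonality from the three term relation *)

Lemma map_mx_cmxl (u : {scalar {mpoly R[d]}}) m n k (A : 'M[R]_(m, n))
    (Y : 'M[{mpoly R[d]}]_(n, k)) :
  map_mx u (cmx d A *m Y) = A *m map_mx u Y.
Proof.
apply/matrixP => i j; rewrite !mxE raddf_sum; apply: eq_bigr => l _.
by rewrite !mxE mul_mpolyC /= scalarZ.
Qed.

Lemma map_mx_cmxr (u : {scalar {mpoly R[d]}}) m n k (A : 'M[R]_(m, n))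
    (Y : 'M[{mpoly R[d]}]_(k, n)) :
  map_mx u (Y *m (cmx d A)^T) = map_mx u Y *m A^T.
Proof.
apply/matrixP => i j; rewrite !mxE raddf_sum; apply: eq_bigr => l _.
by rewrite !mxE mulrC mul_mpolyC /= scalarZ mulrC.
Qed.

Section ThreeTerm.

Variables (Q : vecseq R d) (u : {scalar {mpoly R[d]}}).
Variables (A : forall n, 'I_d -> 'M[R]_(r d n, r d n.+1))
  (B : forall n, 'I_d -> 'M[R]_(r d n, r d n))
  (C : forall n, 'I_d -> 'M[R]_(r d n, r d n.-1)).
Hypothesis ttQ : three_term A B C Q.

(** Write [x^m = x^m' x_i] and expand [x_i Q_n]: the degree of the monomial
    drops by one while the index of [Q] drops by at most one, so the inequality
    [mdeg m < n] survives. *)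
Lemma orth_low_monomials : (forall n, map_mx u (Q n.+1) = 0) ->
  forall m n, (mdeg m < n)%N -> map_mx u ('X_[m] *: Q n) = 0.
Proof.
move=> u0 m; move e : (mdeg m) => N; elim: N m e => [|N IH] m e [//|n] lt.
  by move/eqP: e; rewrite mdeg_eq0 => /eqP->; rewrite mpolyX0 scale1r u0.
have [i [m' [-> deg]]] := mdegS_split e.
rewrite addmC mpolyXD -scalerA ttQ !scalerDr !scalemxAr !map_mxD.
by rewrite !map_mx_cmxl !(IH _ deg) ?mulmx0 ?addr0 // ltnW // ltnW.
Qed.

Lemma orth_low p n k : (forall n, map_mx u (Q n.+1) = 0) ->
  (msize p <= n)%N -> u (p * Q n k 0) = 0.
Proof.
move=> u0 sp; rewrite [p]mpolyE mulr_suml raddf_sum big_seq big1 //= => m pm.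
rewrite -scalerAl scalarZ.
have /colP/(_ k) : map_mx u ('X_[m] *: Q n) = 0.
  by apply: orth_low_monomials => //; apply: leq_trans sp; apply: msize_mdeg_lt.
by rewrite !mxE => ->; rewrite mulr0.
Qed.

Lemma orth_of_dual : monic_leading Q -> (forall n, map_mx u (Q n.+1) = 0) ->
  forall n m, n <> m -> map_mx u (Q n *m (Q m)^T) = 0.
Proof.
move=> monQ u0 n m /eqP nm; apply/matrixP => a b.
rewrite mxE [(_ *m _) _ _]mxE big_ord1 [_^T _ _]mxE mxE.
case: ltngtP nm => // lt _; first by rewrite orth_low // monic_msize.
by rewrite mulrC orth_low // monic_msize.
Qed.

(** Both sides equal [u (x_i Q_(n+1) Q_n^T)]: let [x_i] act on the left factor,
    where only the trailing coefficient survives, or on the right factor, where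
    only the leading one does. *)
Lemma gram_recurrence n i :
    (forall n m, n <> m -> map_mx u (Q n *m (Q m)^T) = 0) ->
  C n.+1 i *m map_mx u (Q n *m (Q n)^T) =
  map_mx u (Q n.+1 *m (Q n.+1)^T) *m (A n i)^T.
Proof.
move=> orth.
have ort m k : m != k -> map_mx u (Q m *m (Q k)^T) = 0 by move/eqP/orth.
transitivity (map_mx u (('X_i *: Q n.+1) *m (Q n)^T)).
  rewrite (ttQ n.+1 i) !mulmxDl -!mulmxA !map_mxD !map_mx_cmxl.
  by rewrite (ort n.+2 n) ?(ort n.+1 n) ?gtn_eqF // !mulmx0 !add0r.
have -> : 'X_i *: Q n.+1 *m (Q n)^T = Q n.+1 *m ('X_i *: Q n)^T.
  by apply/matrixP => a b; rewrite !mxE !big_ord1 !mxE; ring.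
have trD m (X Y : 'cV[{mpoly R[d]}]_m) : (X + Y)^T = X^T + Y^T.
  by apply/matrixP => a b; rewrite !mxE.
rewrite (ttQ n i) !trD !mulmxDr !map_mxD !trmx_mul !mulmxA !map_mx_cmxr.
rewrite (ort _ n) ?gtn_eqF // mul0mx addr0.
case: n => [|n] /=; first by rewrite trmx0 mulmx0 map_mx0 mul0mx addr0.
by rewrite (ort _ n) ?gtn_eqF // mul0mx addr0.
Qed.

End ThreeTerm.

(** Compare the coefficients of the monomials of degree [n + 1]: only the
    monomials of [x_i Q_n] coming from the leading part of [Q_n] reach that
    degree. *)
Lemma lead_coefficients Q A B C : monic_leading Q -> three_term A B C Q ->
  forall n i, A n i = lead_mx R n i.
Proof.
move=> monQ ttQ n i; apply/matrixP => a b.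
have bdeg := mdeg_monomial b.
have lowprev : ((cmx d (C n i) *m prevvec Q n) a 0)@_(monomial b) = 0.
  case: n a b bdeg => [|n] a b bdeg; first by rewrite mulmx0 mxE mcoeff0.
  by rewrite (cmx_mul_coeff_high _ _ monQ) ?bdeg.
move/colP/(_ a)/(congr1 (mcoeff (monomial b))): (ttQ n i).
have entryD (X Y : 'cV[{mpoly R[d]}]_(r d n)) :
    ((X + Y) a 0)@_(monomial b) = (X a 0)@_(monomial b) + (Y a 0)@_(monomial b).
  by rewrite mxE mcoeffD.
rewrite !entryD lowprev (cmx_mul_coeff_high (n := n) _ _ monQ) ?bdeg // !addr0.
rewrite cmx_mulE (monic_comb_coeff _ _ monQ) => <-.
rewrite mxE [X in X@_ _](_ : _ = 'X_i * monvec R d n a 0 +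
  'X_i * (Q n - monvec R d n) a 0); last by rewrite !mxE; ring.
rewrite mcoeffD [X in _ + X](_ : _ = 0) ?addr0; last first.
  have /msize_leP low' : (msize ('X_i * (Q n - monvec R d n) a 0)%R <= n.+1)%N.
    have [->|nz] := eqVneq ((Q n - monvec R d n) a 0) 0.
      by rewrite mulr0 msize0.
    rewrite msizeM ?msizeX ?mdeg1 //=; first exact: monQ.
    by rewrite -msize_poly_eq0 msizeX.
  by rewrite low' ?bdeg.
by rewrite [RHS]mxE.
Qed.

(** * Orthogonality and the rank conditions *)

Lemma orthogonal_ranks Q u A B C : orthogonal_for u Q -> monic_leading Q ->
    three_term A B C Q ->
  forall n, (forall i, \rank (C n.+1 i) = r d n) /\
    \rank (\mxcol_(i < d) (C n.+1 i)^T) = r d n.+1.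
Proof.
move=> [_ orth unitH] monQ ttQ n.
have AL := lead_coefficients monQ ttQ.
have CH i := gram_recurrence ttQ n i orth.
split=> [i|].
  by apply: (rank_of_gram (unitH n) CH); rewrite ?AL ?row_free_lead.
apply/(unitmx_joint_rank (unitH n) CH) => [w wA|].
  by apply: lead_mx_joint_inj => i; rewrite -AL.
exact: unitH.
Qed.

(** The sufficient half of the multivariate Favard theorem for monic systems:
    orthogonality of distinct vectors is automatic for the dual functional, and
    the rank hypothesis is what carries the invertibility of the Gram matrices
    from one degree to the next. *)
Lemma favard Q A B C : monic_leading Q -> three_term A B C Q ->
    (forall n, \rank (\mxcol_(i < d) (C n.+1 i)^T) = r d n.+1) ->
  exists u : {scalar {mpoly R[d]}}, orthogonal_for u Q.
Proof.
move=> monQ ttQ rankC; have [u [u1 u0]] := exists_dual monQ.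
have orth := orth_of_dual ttQ monQ u0; exists u; split=> //.
  by have [] := monic_systemP monQ.
elim=> [|n IH].
  (* In degree 0 the Gram matrix is the 1 x 1 identity. *)
  apply/unitmxP_row => w wH; apply/rowP => k; rewrite mxE.
  have ord_r0 (j : 'I_(r d 0)) : j = 0%N :> nat.
    apply/eqP; rewrite -leqn0 -ltnS (leq_trans (ltn_ord j)) //.
    by rewrite /r add0n binn.
  have one j : j = k by apply: val_inj; rewrite /= !ord_r0.
  move/rowP/(_ k): wH; rewrite mxE (bigD1 k) //= big1 => [|j]; last first.
    by rewrite (one j) eqxx.
  by rewrite !mxE big_ord1 !mxE !monic0 // mulr1 u1 mulr1 addr0.
apply/(unitmx_joint_rank IH (fun i => gram_recurrence ttQ n i orth)) => [w wA|].
  by apply: lead_mx_joint_inj => i; rewrite -(lead_coefficients monQ ttQ).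
exact: rankC.
Qed.

(** * Adding a multiple of the preceding vector *)

(** The computation at one index, for unrelated vectors and sizes, so that the
    first two indices, where some vectors are absent, are instances with zero
    data. *)
Lemma perturbation_step n3 n2 n1 n0 (x : {mpoly R[d]})
    (P3 : 'cV_n3) (P2 : 'cV_n2) (P1 : 'cV_n1) (P0 : 'cV_n0)
    (L : 'M_(n2, n3)) (B Bt : 'M_n2) (C Ct : 'M_(n2, n1))
    (L1 : 'M_(n1, n2)) (B1 : 'M_n1) (C1 : 'M_(n1, n0))
    (M3 : 'M_(n3, n2)) (M2 : 'M_(n2, n1)) (M1 : 'M_(n1, n0)) :
    x *: P2 = cmx d L *m P3 + cmx d B *m P2 + cmx d C *m P1 ->
    x *: P1 = cmx d L1 *m P2 + cmx d B1 *m P1 + cmx d C1 *m P0 ->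
    Bt = B + M2 *m L1 - L *m M3 ->
    Ct = C + M2 *m B1 - Bt *m M2 ->
  x *: (P2 + cmx d M2 *m P1) =
  cmx d L *m (P3 + cmx d M3 *m P2) + cmx d Bt *m (P2 + cmx d M2 *m P1) +
  cmx d Ct *m (P1 + cmx d M1 *m P0) + cmx d (M2 *m C1 - Ct *m M1) *m P0.
Proof.
move=> tt2 tt1 BtE CtE.
have cmxD m k (X Y : 'M[R]_(m, k)) : cmx d (X + Y) = cmx d X + cmx d Y.
  exact: map_mxD.
have cmxN m k (X : 'M[R]_(m, k)) : cmx d (- X) = - cmx d X.
  exact: map_mxN.
have cmxM m k l (X : 'M[R]_(m, k)) (Y : 'M[R]_(k, l)) :
    cmx d (X *m Y) = cmx d X *m cmx d Y.
  exact: map_mxM.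
rewrite scalerDr scalemxAr tt2 tt1 !mulmxDr.
(* Elsewhere [Bt] and [Ct] stay folded: there their terms cancel as such. *)
rewrite [in cmx d Bt *m P2]BtE [in cmx d Ct *m P1]CtE.
rewrite !(cmxD, cmxN, cmxM, mulmxDl, mulNmx, mulmxA).
exact: regroup.
Qed.

Section Perturbation.

Variables (P : vecseq R d).
Variables (A : forall n, 'I_d -> 'M[R]_(r d n, r d n.+1))
  (B : forall n, 'I_d -> 'M[R]_(r d n, r d n))
  (C : forall n, 'I_d -> 'M[R]_(r d n, r d n.-1))
  (M : forall n, 'M[R]_(r d n, r d n.-1)).
Hypothesis monP : monic_leading P.
Hypothesis ttP : three_term A B C P.

Lemma linrel_monic : monic_leading (linrel M P).
Proof.
move=> [|n] k; first exact: monP.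
apply/msize_leP => m nm; rewrite /linrel -addrAC mxE mcoeffD.
have /msize_leP -> // := monP k.
by rewrite add0r (cmx_mul_coeff_high _ _ monP).
Qed.

Lemma linrel_expansion n i :
  'X_i *: linrel M P n.+2 =
  cmx d (lead_mx R n.+2 i) *m linrel M P n.+3 +
  cmx d (Btilde A B M n.+2 i) *m linrel M P n.+2 +
  cmx d (Ctilde A B C M n.+2 i) *m linrel M P n.+1 +
  cmx d (M n.+2 *m C n.+1 i - Ctilde A B C M n.+2 i *m M n.+1) *m P n.
Proof.
have AL := lead_coefficients monP ttP.
have BtE : Btilde A B M n.+2 i =
  B n.+2 i + M n.+2 *m A n.+1 i - A n.+2 i *m M n.+3 by rewrite /Btilde /= !AL.
rewrite -AL.
have CtE : Ctilde A B C M n.+2 i =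
  C n.+2 i + M n.+2 *m B n.+1 i - Btilde A B M n.+2 i *m M n.+2 by [].
exact: (perturbation_step (M n.+1) (ttP n.+2 i) (ttP n.+1 i) BtE CtE).
Qed.

Lemma linrel_expansion_low n i : (n < 2)%N ->
  'X_i *: linrel M P n =
  cmx d (lead_mx R n i) *m linrel M P n.+1 +
  cmx d (Btilde A B M n i) *m linrel M P n +
  cmx d (Ctilde A B C M n i) *m prevvec (linrel M P) n.
Proof.
have AL := lead_coefficients monP ttP.
case: n => [|[|//]] _.
  (* The relation for the absent vector P_(-1) = 0; P_(-2) gets size 0. *)
  have tt1 : 'X_i *: 0 = cmx d 0 *m P 0%N + cmx d (B 0%N i) *m 0 +
      cmx d 0 *m (0 : 'cV_0).
    by rewrite scaler0 !mulmx0 [cmx d 0]map_mx0 mul0mx !addr0.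
  have BtE : Btilde A B M 0 i = B 0%N i + M 0%N *m 0 - A 0%N i *m M 1%N.
    by rewrite /Btilde /= AL mulmx0.
  have := perturbation_step 0 (ttP 0%N i) tt1 BtE (erefl _).
  by rewrite !mulmx0 !addr0 -AL mulmx0 addr0.
have BtE : Btilde A B M 1 i =
  B 1%N i + M 1%N *m A 0%N i - A 1%N i *m M 2%N by rewrite /Btilde /= !AL.
(* With P_(-1) = 0 the term left over vanishes whatever multiplies it. *)
have := perturbation_step 0 (ttP 1%N i) (ttP 0%N i) BtE (erefl _).
by rewrite /= !mulmx0 !addr0 -AL.
Qed.

End Perturbation.
End Systems.

Theorem theorem4 (R : realType) (d : nat) (d_gt0 : (0 < d)%N)
    (P : vecseq R d)
    (A : forall n, 'I_d -> 'M[R]_(r d n, r d n.+1))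
    (B : forall n, 'I_d -> 'M[R]_(r d n, r d n))
    (C : forall n, 'I_d -> 'M[R]_(r d n, r d n.-1))
    (M : forall n, 'M[R]_(r d n, r d n.-1))
    (P_monic_orthogonal : monic_orthogonal P)
    (P_three_term : three_term A B C P)
    (rank_M1 : \rank (M 1%N) = 1%N) :
  let Q := linrel M P in
  let At := @lead_mx R d in
  let Bt := Btilde A B M in
  let Ct := Ctilde A B C M in
  (monic_orthogonal Q /\ three_term At Bt Ct Q) <->
  ((forall n i, (2 <= n)%N -> M n *m C n.-1 i = Ct n i *m M n.-1) /\
   (forall n, (forall i, \rank (Ct n.+1 i) = r d n) /\
      \rank (\mxcol_(i < d) (Ct n.+1 i)^T) = r d n.+1)).
Proof.
move=> Q At Bt Ct; have [[_ monP] _] := P_monic_orthogonal.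
have monQ : monic_leading Q by apply: linrel_monic.
split=> [[[_ [u orthQ]] ttQ]|[commC rankC]].
  split=> [[|[|n]] // i _|]; last exact: orthogonal_ranks orthQ monQ ttQ.
  apply/eqP; rewrite -subr_eq0; apply/eqP; apply: (cmx_mul_eq0 d_gt0 monP).
  have := linrel_expansion d_gt0 M monP P_three_term n i.
  by rewrite (ttQ n.+2 i) -[LHS]addr0 => /addrI <-.
have ttQ : three_term At Bt Ct Q.
  case=> [|[|n]] i; [exact: linrel_expansion_low..|].
  rewrite (linrel_expansion d_gt0 M monP P_three_term).
  have /= -> := commC n.+2 i isT.
  by rewrite subrr [cmx d 0]map_mx0 mul0mx addr0.
split=> //; split; first exact: monic_systemP.
by apply: favard ttQ _ => // n; have [] := rankC n.
Qed.
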